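(* Let $q=2^h$ with $h\geq 3$, and let $\alpha,\beta\in\mathbb{F}_{q^2}^{*}$. Let $$f_{\alpha,\beta}(x)=x+\alpha x^{q(q-1)+1}+\beta x^{2(q-1)+1}\in\mathbb{F}_{q^2}[x].$$ Then $f_{\alpha,\beta}$ is a permutation of $\mathbb{F}_{q^2}$ if and only if one of the following holds: \begin{enumerate} \item $\beta=\alpha^{q-1}$ and $Tr\left(1+\frac{1}{\alpha^{q+1}}\right)=0$; \item $\beta(1+\alpha^{q+1}+\beta^{q+1})+\alpha^{2q}=0$, $\beta^{q+1}\neq 1$, and $Tr\left(\frac{\beta^{q+1}}{\alpha^{q+1}}\right)=0$. \end{enumerate}
   Context: $Tr:\mathbb{F}_q\to\mathbb{F}_2$ denotes the absolute trace, $Tr(z)=z+z^2+z^{2^2}+\cdots+z^{2^{h-1}}$. Note that $\alpha^{q+1},\beta^{q+1}\in\mathbb{F}_q$. A permutation of $\mathbb{F}_{q^2}$ means the map $x\mapsto f_{\alpha,\beta}(x)$ is a bijection of $\mathbb{F}_{q^2}$. *)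

(* Defs.v *)
From mathcomp Require Import all_boot all_order all_algebra.
Set Implicit Arguments. Unset Strict Implicit. Unset Printing Implicit Defensive.
Import GRing.Theory.
Local Open Scope ring_scope.

(* Absolute trace F_{2^h} -> F_2, computed inside the ambient field F:
   absTr h z = z + z^2 + z^(2^2) + ... + z^(2^(h-1)). *)
Definition absTr (F : fieldType) (h : nat) (z : F) : F :=
  \sum_(i < h) z ^+ (2 ^ i).

Definition f_ab (F : fieldType) (q : nat) (a b : F) (x : F) : F :=
  x + a * x ^+ (q * (q - 1) + 1) + b * x ^+ (2 * (q - 1) + 1).

(* Main.v *)
(** The identity f(x)^(q-1) = g(x^(q-1)) on the units reduces the problem to the
    degree three rational function
      g(y) = (a^q y^3 + y^2 + b^q) / (b y^3 + y + a)
    on the circle mu of elements of norm 1.  For t in mu the equation g(y) = t is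
    the self-reciprocal cubic A y^3 + y^2 + t y + t A^q with A = a^q + t b, and the
    quadratic resolvent of a cubic in characteristic 2 shows that it has exactly
    one root in mu iff Tr(R(t)) = 0, where R(t) is the element [resolvent a b t].
    So f is a permutation iff Tr(R(t)) vanishes for all t off the zeros of the
    denominator D(t) of R (plus conditions at these zeros).  After a scaling
    x -> k x we have ab in F_q, and D(t) = E + ab (t + 1/t).  A Moebius change
    of variable moves the zeros of D to 0 and oo (E <> 0; the new variable runs
    over F_q^* or over mu) or, if they coincide, to oo (E = 0).  Then R becomes a
    Laurent polynomial of small degree, and since the exponents 2^i are distinct
    modulo q - 1 and q + 1 for q >= 8, orthogonality of characters forces R to be
    of the form u^2 + u + constant.  These equations on the coefficients give the
    two cases. *)

Require Import Defs.
From Stdlib Require Import BinNat Ring_theory Ring_polynom InitialRing Field_theory.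
From mathcomp Require Import all_boot all_order all_algebra all_solvable all_field zify.
Import GRing.Theory.
Set Implicit Arguments. Unset Strict Implicit. Unset Printing Implicit Defensive.
Local Open Scope ring_scope.

(** * Field identities in characteristic 2 by reflection *)

Section Char2Field.
Variables (F : fieldType) (F2 : 2 \in [pchar F]).

Let sub2 (x y : F) := x - y.
Let div2 (x y : F) := x / y.
Let boolr (b : bool) : F := b%:R.

Lemma ext2 : ring_eq_ext +%R *%R -%R (@eq F).
Proof. by split=> [x ? <- y ? <-|x ? <- y ? <-|x ? <-]. Qed.

Lemma ring_theory2 : ring_theory 0 1 +%R *%R sub2 -%R (@eq F).
Proof.
split=> //; [exact: add0r|exact: addrC|exact: addrA|exact: mul1r|exact: mulrC
  |exact: mulrA|exact: mulrDl|exact: subrr].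
Qed.

Lemma field_theory2 : field_theory 0 1 +%R *%R sub2 -%R div2 GRing.inv (@eq F).
Proof.
split=> //; [exact: ring_theory2|by apply/eqP; rewrite oner_neq0|].
by move=> x /eqP x0; rewrite mulVf.
Qed.

Lemma bool_morph : ring_morph 0 1 +%R *%R sub2 -%R (@eq F)
  false true addb andb addb id Bool.eqb boolr.
Proof.
have p2 : 1 + 1 = 0 :> F by rewrite -[RHS](pcharf0 F2).
rewrite /boolr; split=> //; rewrite /sub2.
- by case=> [] []; rewrite ?addr0 ?add0r ?p2.
- by case=> [] []; rewrite ?subr0 ?sub0r ?subrr ?(oppr_pchar2 F2).
- by case=> [] []; rewrite ?mul1r ?mul0r.
- by case; rewrite ?(oppr_pchar2 F2).
- by case=> [] [].
Qed.

Lemma power_theory2 :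
  power_theory 1 *%R (@eq F) N.to_nat (fun x : F => GRing.exp x).
Proof.
split=> x [|p] //=; rewrite /N.to_nat.
elim: p => /= [p IH|p IH|//].
- by rewrite -IH Pnat.Pos2Nat.inj_xI exprS -exprD addnn -mul2n.
- by rewrite -IH Pnat.Pos2Nat.inj_xO -exprD addnn -mul2n.
Qed.

Definition eval2 : seq F -> FExpr bool -> F :=
  FEeval 0 1 +%R *%R sub2 -%R div2 GRing.inv boolr N.to_nat (fun x : F => GRing.exp x).

Definition peval2 : seq F -> PExpr bool -> F :=
  PEeval 0 1 +%R *%R sub2 -%R boolr N.to_nat (fun x : F => GRing.exp x).

Definition norm2 (e : FExpr bool) :=
  Fnorm false true addb andb addb id Bool.eqb e.

Definition nsubst2 := norm_subst false true addb andb addb id Bool.eqb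
   (triv_div false true Bool.eqb) 0 [::].

(** Side conditions are stated with [!= 0], as in the goals, and the conjunction ends in [True] so
    that [split_conds] can recurse uniformly. *)
Fixpoint cond2 (l : seq F) (s : seq (PExpr bool)) : Prop :=
  if s is e :: s' then peval2 l e != 0 /\ cond2 l s' else True.

Lemma field2_correct l e1 e2 :
  Peq Bool.eqb (nsubst2 (PEmul (num (norm2 e1)) (denum (norm2 e2))))
                  (nsubst2 (PEmul (num (norm2 e2)) (denum (norm2 e1)))) = true ->
  cond2 l (Fapp (Fcons00 false true addb andb addb id Bool.eqb
     (triv_div false true Bool.eqb)) (condition (norm2 e1) ++ condition (norm2 e2)) [::]) ->
  eval2 l e1 = eval2 l e2.
Proof.
move=> eqn cnd.
have At := F2AF (Eqsth F) ext2 field_theory2.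
have Dt := triv_div_th (Eqsth F) ext2 (Rth_ARth (Eqsth F) ext2 ring_theory2) bool_morph.
apply: (@Field_correct _ _ _ _ _ _ _ _ _ _ (Eqsth F) ext2 (congr1 GRing.inv) At
  _ _ _ _ _ _ _ _ _ bool_morph _ _ _ power_theory2 _ Dt 0%N l [::] e1 e2 I _ erefl
  _ erefl _ erefl eqn).
apply: (Pcond_simpl_gen (Eqsth F) ext2 At bool_morph power_theory2 Dt) => _ ->.
elim: (Fapp _ _ _) cnd => [|e s IH] //= [/eqP e0 /IH]; case: s {IH} => //= a s.
Qed.

End Char2Field.

(* [field2 c], with [c : 2 \in [pchar F]], decides field identities of
   characteristic 2 by reflection with coefficients in [bool] (the tactics [ring]
   and [field] normalize over Z and do not know 2 = 0), leaving the non-vanishing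
   of the denominators. *)
Ltac in_list x l := lazymatch l with
  | nil => constr:(false)
  | cons x _ => constr:(true)
  | cons _ ?l' => in_list x l' end.

Ltac add_atom x l := let b := in_list x l in
  lazymatch b with true => l | false => constr:(cons x l) end.

Ltac closed_nat n := lazymatch n with
  | O => constr:(true) | S ?m => closed_nat m
  | _ => constr:(false) end.

Ltac atoms t l := lazymatch t with
  | 0%R => l | 1%R => l
  | (?x + ?y)%R => let l' := atoms x l in atoms y l'
  | (?x * ?y)%R => let l' := atoms x l in atoms y l'
  | (- ?x)%R => atoms x l
  | (?x^-1)%R => atoms x l
  | (?x ^+ ?n)%R => let m := eval compute in n in
       let b := closed_nat m in
       lazymatch b with true => atoms x l | false => add_atom t l end
  | _ => add_atom t l end.

Ltac index x l := lazymatch l with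
  | cons x _ => constr:(xH)
  | cons _ ?l' => let p := index x l' in eval compute in (BinPos.Pos.succ p) end.

Ltac reify t l := lazymatch t with
  | 0%R => constr:(@FEO bool) | 1%R => constr:(@FEI bool)
  | (?x + ?y)%R => let a := reify x l in let b := reify y l in constr:(FEadd a b)
  | (?x * ?y)%R => let a := reify x l in let b := reify y l in constr:(FEmul a b)
  | (- ?x)%R => let a := reify x l in constr:(FEopp a)
  | (?x^-1)%R => let a := reify x l in constr:(FEinv a)
  | (?x ^+ ?n)%R => let m := eval compute in n in
       let b := closed_nat m in
       lazymatch b with
       | true => let a := reify x l in
                 let k := eval compute in (BinNat.N.of_nat m) in constr:(FEpow a k)
       | false => let p := index t l in constr:(FEX bool p) end
  | _ => let p := index t l in constr:(FEX bool p) end.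

Ltac split_conds := lazymatch goal with
  | |- True => exact I
  | |- _ /\ _ => split; [try first [assumption | exact (oner_neq0 _)] | split_conds] end.

Ltac field2 c := lazymatch goal with
  |- @eq ?T ?x ?y =>
    let l0 := atoms x (@nil T) in let l := atoms y l0 in
    let e1 := reify x l in let e2 := reify y l in
    refine (@field2_correct _ c l e1 e2 _ _);
    [vm_compute; reflexivity
    |let s := fresh in
     match goal with |- cond2 _ ?s0 => set s := s0 end; vm_compute in s; subst s;
     cbv beta iota zeta delta [cond2 peval2 PEeval BinList.nth BinList.jump List.hd List.tl N.to_nat
        BinPos.Pos.to_nat BinPos.Pos.iter_op Nat.add];
     split_conds]
 end.

(** For a field of order q^2 this is the involution with fixed field F_q; below, [c x = x] expresses
    that [x] lies in F_q and [x * c x] is the norm. *)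
Definition conjq (F : fieldType) (h : nat) (x : F) : F := x ^+ (2 ^ h).

(** * Conjugation, absolute trace and the equation u^2 + u = x *)

Section ArtinSchreier.
Variables (F : finFieldType) (h : nat).
Hypotheses (h_gt0 : (0 < h)%N) (cardF : (#|F| = (2 ^ h) ^ 2)%N).
Local Notation c := (conjq h).
Local Notation Tr := (absTr h).

Lemma pchar2 : 2 \in [pchar F].
Proof. by apply: (@card_finPcharP _ _ (h * 2)%N) => //; rewrite cardF expnM. Qed.

Lemma exp2nD n (x y : F) : (x + y) ^+ (2 ^ n) = x ^+ (2 ^ n) + y ^+ (2 ^ n).
Proof. by rewrite exprDn_pchar // pnatX pnatE ?pchar2. Qed.

Lemma exp2n_sum n I (r : seq I) (f : I -> F) :
  (\sum_(i <- r) f i) ^+ (2 ^ n) = \sum_(i <- r) f i ^+ (2 ^ n).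
Proof.
elim/big_rec2: _ => [|i x y _ <-]; last exact: exp2nD.
by rewrite expr0n -leqn0 leqNgt expn_gt0.
Qed.

Lemma addxx2 (x : F) : x + x = 0.
Proof. exact: addrr_pchar2 pchar2 x. Qed.

Lemma addr_eq0_2 (x y : F) : (x + y == 0) = (x == y).
Proof. by rewrite addr_eq0 oppr_pchar2 ?pchar2. Qed.

Lemma sqr_eq_2 (x y : F) : (x ^+ 2 == y ^+ 2) = (x == y).
Proof.
have := exp2nD 1 x y; rewrite expn1 -[x ^+ 2 == _]addr_eq0_2 => <-.
by rewrite expf_eq0 addr_eq0_2.
Qed.

Lemma conjD x y : c (x + y) = c x + c y :> F. Proof. exact: exp2nD. Qed.
Lemma conjM x y : c (x * y) = c x * c y :> F. Proof. exact: exprMn. Qed.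
Lemma conjX x n : c (x ^+ n) = c x ^+ n :> F. Proof. by rewrite /conjq exprAC. Qed.
Lemma conjV x : c x^-1 = (c x)^-1 :> F. Proof. exact: exprVn. Qed.
Lemma conj1 : c 1 = 1 :> F. Proof. exact: expr1n. Qed.
Lemma conjK x : c (c x) = x :> F.
Proof. by rewrite /conjq -exprM mulnn -cardF expf_card. Qed.
Lemma conj0 : c 0 = 0 :> F.
Proof. by rewrite /conjq expr0n -leqn0 leqNgt expn_gt0. Qed.
Lemma conj_eq0 x : (c x == 0 :> F) = (x == 0).
Proof. by rewrite expf_eq0 expn_gt0. Qed.
Definition conjE := (conjD, conjM, conjX, conjV, conj1, conjK).

Lemma absTrD n x y : absTr n (x + y) = absTr n x + absTr n y :> F.
Proof. by rewrite -big_split; apply: eq_bigr => i _; rewrite exp2nD. Qed.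

Lemma absTr_AS n (u : F) : absTr n (u ^+ 2 + u) = u ^+ (2 ^ n) + u.
Proof.
elim: n => [|n IH]; first by rewrite /absTr big_ord0 expn0 expr1 addxx2.
rewrite /absTr big_ord_recr /= -/(absTr n _) IH exp2nD -exprM -expnS.
by field2 pchar2.
Qed.

Lemma AS_fiber (y : F) : (#|[set x : F | (x ^+ 2 + x == y)%R]| <= 2)%N.
Proof.
have [->|[x0]] := set_0Vmem [set x : F | (x ^+ 2 + x == y)%R]; first by rewrite cards0.
rewrite inE => /eqP x0y.
apply: (@leq_trans #|[set x0; (x0 + 1)%R]|); last by rewrite cards2; case: eqP.
apply/subset_leq_card/subsetP=> x; rewrite !inE -{}x0y -addr_eq0_2.
have -> : x ^+ 2 + x + (x0 ^+ 2 + x0) = (x + x0) * (x + (x0 + 1)) by field2 pchar2.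
by rewrite mulf_eq0 !addr_eq0_2.
Qed.

(* The image of [u |-> u^2 + u] has at least [q^2/2] elements and lies in the
   kernel of the absolute trace of [F], a polynomial of degree [q^2/2]. *)
Lemma AS_solve (x : F) : c x = x -> exists u, u ^+ 2 + u = x.
Proof.
move=> xr; pose m := (h * 2)%N; pose phi := fun u : F => u ^+ 2 + u.
have cm : #|F| = (2 ^ m)%N by rewrite cardF expnM.
pose P : {poly F} := \sum_(i < m) 'X^(2 ^ i).
have Pe y : P.[y] = absTr m y.
  by rewrite horner_sum; apply: eq_bigr => i _; rewrite hornerXn.
have m1 : m = m.-1.+1 by rewrite prednK ?muln_gt0 ?h_gt0.
have sP : size P = (2 ^ m.-1).+1.
  rewrite /P m1 big_ord_recr /= addrC size_polyDl ?size_polyXn //.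
  apply: leq_ltn_trans (size_sum _ _ _) _; rewrite ltnS.
  by apply/bigmax_leqP => i _; rewrite size_polyXn ltn_exp2l.
have P0 : P != 0 by rewrite -size_poly_eq0 sP.
have sub : [set phi u | u in [set: F]] \subset [set y | root P y].
  apply/subsetP => _ /imsetP[u _ ->]; rewrite inE /root Pe absTr_AS -cm expf_card.
  by rewrite addxx2.
(* The trace of [F] splits into the exponents below h and those from h on; both halves agree at [x]
   because [c x = x], so they cancel. *)
have xP : x \in [set y | root P y].
  rewrite inE /root Pe /absTr /m muln2 -addnn big_split_ord /=.
  apply/eqP; rewrite -[RHS](addxx2 (absTr h x)); congr (_ + _).
  by apply: eq_bigr => i _; rewrite expnD exprM [x ^+ _]xr.
suff /eqP e : [set phi u | u in [set: F]] == [set y | root P y].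
  by move: xP; rewrite -e => /imsetP[u _ ->]; exists u.
rewrite eqEcard sub /=.
have le1 : (#|[set y | root P y]| <= 2 ^ m.-1)%N.
  rewrite -ltnS -sP cardE; apply: max_poly_roots => //; last exact: enum_uniq.
  by apply/allP => y; rewrite mem_enum inE.
apply: leq_trans le1 _; rewrite -(leq_pmul2r (m := 2)) // -expnSr -m1 -cm.
rewrite -cardsT -sum1_card (partition_big_imset phi) /= -sum_nat_const.
apply: leq_sum => y _; rewrite sum1dep_card; apply: leq_trans (AS_fiber y).
by apply/subset_leq_card/subsetP => u; rewrite !inE.
Qed.

Lemma Tr_AS (u : F) : Tr (u ^+ 2 + u) = c u + u. Proof. exact: absTr_AS. Qed.

Lemma Tr_AS_real (x u : F) : c u = u -> Tr (x + (u ^+ 2 + u)) = Tr x.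
Proof. by move=> ur; rewrite absTrD Tr_AS ur addxx2 addr0. Qed.

(** Write x = u^2 + u. As [c] fixes [x], the trace d = c u + u satisfies d^2 + d = 0. *)
Lemma Tr01 (x : F) : c x = x -> Tr x = 0 \/ Tr x = 1.
Proof.
move=> xr; have [u ux] := AS_solve xr.
have : (c u ^+ 2 + c u) = u ^+ 2 + u by rewrite -conjX -conjD ux.
rewrite -{1}ux Tr_AS => /eqP; rewrite -addr_eq0_2 -ux Tr_AS.
have -> : c u ^+ 2 + c u + (u ^+ 2 + u) = (c u + u) * (c u + u + 1) by field2 pchar2.
rewrite mulf_eq0 => /orP[/eqP|]; first by left.
by rewrite addr_eq0_2 => /eqP; right.
Qed.


(** * Orthogonality of characters and powers of 2 modulo q - 1 and q + 1 *)

Lemma sum_geom_root n (x : F) : odd n -> x ^+ n = 1 ->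
  \sum_(i < n) x ^+ i = (x == 1)%:R.
Proof.
move=> n_odd xn; have [->|x1] := eqVneq x 1.
  under eq_bigr do rewrite expr1n.
  rewrite sumr_const card_ord -[n]odd_double_half n_odd mulrnDr -mul2n mulrnA.
  by rewrite (pcharf0 pchar2) mul0rn addr0.
apply/eqP; have := subrX1 x n; rewrite xn subrr => /esym/eqP.
by rewrite mulf_eq0 subr_eq0 (negbTE x1).
Qed.

(* Orthogonality of the characters [i |-> x ^+ i] of Z/n. *)
Lemma Tr_coef n (s : seq (F * F)) (r : F) : odd n -> r ^+ n = 1 ->
  (forall p, p \in s -> p.2 ^+ n = 1) ->
  (forall i, Tr (\sum_(p <- s) p.1 * p.2 ^+ i) = 0) ->
  \sum_(l < h) \sum_(p <- s) p.1 ^+ (2 ^ l) * (p.2 ^+ (2 ^ l) == r)%:R = 0.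
Proof.
move=> n_odd rn sn s0; have r0 : r != 0.
  by apply/eqP => r0; move: rn n_odd; rewrite r0 expr0n; case: n {sn} => //= n /esym/eqP; rewrite oner_eq0.
have z0 : \sum_(i < n) r^-1 ^+ i * Tr (\sum_(p <- s) p.1 * p.2 ^+ i) = 0.
  by apply: big1 => i _; rewrite s0 mulr0.
rewrite -[RHS]z0.
under [RHS]eq_bigr do rewrite /absTr mulr_sumr.
rewrite [RHS]exchange_big; apply: eq_bigr => l _ /=.
under [RHS]eq_bigr do rewrite exp2n_sum mulr_sumr.
rewrite [RHS]exchange_big !big_seq; apply: eq_bigr => p ps /=.
have -> : (p.2 ^+ (2 ^ l) == r) = (p.2 ^+ (2 ^ l) / r == 1).
  by rewrite -[RHS](inj_eq (mulIf r0)) mulfVK // mul1r.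
rewrite -(@sum_geom_root n) //; last first.
  by rewrite exprMn exprVn rn invr1 mulr1 exprAC sn // expr1n.
rewrite mulr_sumr; apply: eq_bigr => i _.
by rewrite !exprMn [RHS]mulrCA [(p.2 ^+ i) ^+ _]exprAC [_^-1 ^+ i * _]mulrC.
Qed.

Lemma exp2_ge8 : (3 <= h)%N -> (8 <= 2 ^ h)%N.
Proof. by move=> h3; rewrite -[8%N]/(2 ^ 3)%N leq_exp2l. Qed.

(** Powers of 2 below 8 are listed and the others are kept through their residue modulo 8, which
    reduces the congruences below to linear arithmetic. *)
Lemma exp2_cases m : (2 ^ m = 1 /\ m = 0 \/ 2 ^ m = 2 /\ m = 1 \/
  2 ^ m = 4 /\ m = 2 \/ 2 ^ m %% 8 = 0 /\ 8 <= 2 ^ m)%N.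
Proof.
case: m => [|[|[|m]]]; [by left|by right; left|by right; right; left|].
right; right; right; rewrite -addn3 expnD modnMl; split=> //.
by rewrite leq_pmull // expn_gt0.
Qed.

(** The trace turns a term s^j into terms s^(j 2^m); this congruence and the next ones tell which of
    them meet the exponent under comparison. Here 2^m is at most n + 1, so its quotient by n is at
    most 1. *)
Lemma exp2_eq2_mod n m : (3 <= h)%N -> (m <= h)%N -> (n = 2 ^ h - 1 \/ n = 2 ^ h + 1)%N ->
  (2 ^ m == 2 %[mod n]) = (m == 1)%N.
Proof.
move=> h3 mh hn; have le1 : (2 ^ m <= 2 ^ h)%N by rewrite leq_exp2l.
have le2 := exp2_ge8 h3.
apply/eqP/eqP=> [e|-> //].
have d1 := divn_eq (2 ^ m) n; rewrite e (@modn_small 2) in d1; last lia.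
have k2 : ((2 ^ m) %/ n < 2)%N by rewrite ltn_divLR; lia.
move: (_ %/ _)%N (exp2_cases m) k2 d1 => k cm k2 d1 {e}.
by case: k k2 d1 => [|[|]] //= _; lia.
Qed.

Lemma exp2_add2_mod n m : (3 <= h)%N -> (m <= h)%N -> (n = 2 ^ h - 1 \/ n = 2 ^ h + 1)%N ->
  (n %| 2 ^ m + 2)%N = false.
Proof.
move=> h3 mh hn; have le1 : (2 ^ m <= 2 ^ h)%N by rewrite leq_exp2l.
have le2 := exp2_ge8 h3.
apply/negP => /dvdnP[k kn].
have k2 : (k < 2)%N by rewrite -(ltn_pmul2r (m := n)) -?kn; lia.
move: (exp2_cases m) (exp2_cases h) => cm ch.
by case: k k2 kn => [|[|]] //= _; lia.
Qed.

Lemma exp2_eq34_mod m : (3 <= h)%N -> (m <= h.+1)%N ->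
  ((2 ^ m == 3 %[mod 2 ^ h - 1]) = false) * ((2 ^ m == 4 %[mod 2 ^ h - 1]) = (m == 2)%N).
Proof.
move=> h3 mh; have le1 : (2 ^ m <= 2 * 2 ^ h)%N by rewrite -expnS leq_exp2l.
have le2 := exp2_ge8 h3.
have k2 : ((2 ^ m) %/ (2 ^ h - 1) < 3)%N by rewrite ltn_divLR; lia.
have d1 := divn_eq (2 ^ m) (2 ^ h - 1).
split.
  apply/negP => /eqP e; rewrite e modn_small in d1; last lia.
  move: (_ %/ _)%N (exp2_cases m) (exp2_cases h) k2 d1 => k cm ch k2 d1 {e}.
  by case: k k2 d1 => [|[|[|]]] //= _; lia.
apply/eqP/eqP => [e|-> //]; rewrite e modn_small in d1; last lia.
move: (_ %/ _)%N (exp2_cases m) (exp2_cases h) k2 d1 => k cm ch k2 d1 {e}.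
by case: k k2 d1 => [|[|[|]]] //= _; lia.
Qed.

Lemma exp2_mul3_mod m : (3 <= h)%N -> (m < h)%N ->
  (3 * 2 ^ m == 3 %[mod 2 ^ h - 1]) = (m == 0)%N.
Proof.
move=> h3 mh; have le1 : (2 * 2 ^ m <= 2 ^ h)%N by rewrite -expnS leq_exp2l.
have le2 := exp2_ge8 h3.
have k2 : ((3 * 2 ^ m) %/ (2 ^ h - 1) < 2)%N by rewrite ltn_divLR; lia.
have d1 := divn_eq (3 * 2 ^ m) (2 ^ h - 1).
apply/eqP/eqP => [e|-> //]; rewrite e modn_small in d1; last lia.
move: (_ %/ _)%N (exp2_cases m) (exp2_cases h) k2 d1 => k cm ch k2 d1 {e}.
by case: k k2 d1 => [|[|]] //= _; lia.
Qed.

(** Compare the coefficients of s^2 in the trace: for j between -2 and 2 and l < h, the exponent j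
    2^l is 2 modulo n only for j = 2, l = 0 and for j = 1, l = 1. *)
Lemma Tr_laurent2 n (w a4 a3 a2 a1 a0 : F) :
  (3 <= h)%N -> (n = 2 ^ h - 1 \/ n = 2 ^ h + 1)%N -> n.-primitive_root w ->
  (forall i, let s := w ^+ i in
     Tr (a4 * s ^+ 2 + a3 * s + a2 + a1 * s^-1 + a0 * s^-1 ^+ 2) = 0) ->
  a4 = a3 ^+ 2.
Proof.
move=> h3 hn wn H.
have le2 := exp2_ge8 h3.
have wn1 := prim_expr_order wn.
have w0 : w != 0.
  apply/eqP => w0; move: wn1; rewrite w0 expr0n (_ : (n == 0)%N = false); last by lia.
  by move/esym/eqP; rewrite oner_eq0.
have n_odd : odd n.
  have : odd (2 ^ h) = false by rewrite oddX; lia.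
  by case: hn => ->; lia.
pose s := [:: (a4, w ^+ 2); (a3, w); (a2, 1); (a1, w^-1); (a0, w^-1 ^+ 2)].
have h_eq : h = (h - 2).+2 by lia.
have key : \sum_(l < h) \sum_(p <- s) p.1 ^+ (2 ^ l) * (p.2 ^+ (2 ^ l) == w ^+ 2)%:R = 0.
  apply: (@Tr_coef n) => // [|p|i].
  - by rewrite exprAC wn1 expr1n.
  - by rewrite !inE => /or4P[||| /orP[]] /eqP-> //=;
      rewrite ?expr1n ?(exprAC _ _ n) ?exprVn ?wn1 ?invr1 ?expr1n ?invr1.
  - rewrite -[RHS](H i) /s !big_cons big_nil /= addr0 expr1n mulr1 !addrA.
    by rewrite !(exprAC _ _ i) !exprVn.
have ee l : (l <= h)%N -> (w^-1 ^+ (2 ^ l) == w ^+ 2) = false.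
  move=> lh; rewrite exprVn -(inj_eq (mulfI (expf_neq0 (2 ^ l) w0))) mulfV ?expf_neq0 //.
  by rewrite -exprD eq_sym -(prim_order_dvd wn) exp2_add2_mod.
have e1 : (1 == w ^+ 2) = false.
  rewrite eq_sym -(prim_order_dvd wn); apply/negP => /dvdn_leq; lia.
have t l : (l < h)%N -> \sum_(p <- s) p.1 ^+ (2 ^ l) * (p.2 ^+ (2 ^ l) == w ^+ 2)%:R
   = a4 ^+ (2 ^ l) * (l == 0)%:R + a3 ^+ (2 ^ l) * (l == 1)%:R :> F.
  move=> lh; rewrite /s !big_cons big_nil /= -!exprM -!expnS expr1n e1.
  rewrite !ee // ?(ltnW lh) // !(eq_prim_root_expr wn) !exp2_eq2_mod // ?(ltnW lh) //.
  by rewrite !mulr0 !addr0.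
move: key; rewrite (eq_bigr _ (fun l _ => t _ (ltn_ord l))) h_eq !big_ord_recl big1 /=; last first.
  by move=> i _; rewrite !mulr0 addr0.
rewrite expn0 expn1 !expr1 !mulr1 !mulr0 !addr0 add0r => /eqP.
by rewrite addr_eq0_2 => /eqP.
Qed.

(** The coefficient of s^3 in the trace is [q3] alone. Once [q3] vanishes, the coefficient of s^4
    collects [q4], [q2] squared once and [q1] squared twice. *)
Lemma Tr_quartic (w q4 q3 q2 q1 q0 : F) :
  (3 <= h)%N -> (2 ^ h - 1)%N.-primitive_root w ->
  (forall i, let s := w ^+ i in
     Tr (q4 * s ^+ 4 + q3 * s ^+ 3 + q2 * s ^+ 2 + q1 * s + q0) = 0) ->
  q3 = 0 /\ q4 + q2 ^+ 2 + q1 ^+ 4 = 0.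
Proof.
move=> h3 wn H; set n := (2 ^ h - 1)%N in wn.
have le2 := exp2_ge8 h3.
have n_odd : odd n.
  have : odd (2 ^ h) = false by rewrite oddX; lia.
  by rewrite /n; lia.
pose s := [:: (q4, w ^+ 4); (q3, w ^+ 3); (q2, w ^+ 2); (q1, w); (q0, 1)].
have wn1 := prim_expr_order wn.
have h_eq : h = (h - 3).+3 by lia.
have e1 k : (0 < k < 7)%N -> (1 == w ^+ k) = false.
  move=> k7; rewrite eq_sym -(prim_order_dvd wn); apply/negP => /dvdn_leq; lia.
have key k : \sum_(l < h) \sum_(p <- s) p.1 ^+ (2 ^ l) * (p.2 ^+ (2 ^ l) == w ^+ k)%:R = 0.
  apply: (@Tr_coef n) => // [|p|i].
  - by rewrite exprAC wn1 expr1n.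
  - by rewrite !inE => /or4P[||| /orP[]] /eqP-> //=; rewrite ?expr1n ?(exprAC _ _ n) ?wn1 ?expr1n.
  - rewrite -[RHS](H i) /s !big_cons big_nil /= addr0 expr1n mulr1 !addrA.
    by rewrite !(exprAC _ _ i).
have m4 l : (4 * 2 ^ l = 2 ^ l.+2)%N by rewrite !expnS mulnA.
have q3_0 : q3 = 0.
  have t l : (l < h)%N -> \sum_(p <- s) p.1 ^+ (2 ^ l) * (p.2 ^+ (2 ^ l) == w ^+ 3)%:R
     = q3 ^+ (2 ^ l) * (l == 0)%:R :> F.
    move=> lh; rewrite /s !big_cons big_nil /= expr1n e1 // -!exprM.
    rewrite m4 -expnS.
    rewrite !(eq_prim_root_expr wn) exp2_mul3_mod // !exp2_eq34_mod //; try lia.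
    by rewrite !mulr0 !addr0 add0r.
  move: (key 3); rewrite (eq_bigr _ (fun l _ => t _ (ltn_ord l))) h_eq big_ord_recl big1 /=.
    by rewrite expn0 expr1 mulr1 addr0.
  by move=> i _; rewrite mulr0.
split=> //.
have t l : (l < h)%N -> \sum_(p <- s) p.1 ^+ (2 ^ l) * (p.2 ^+ (2 ^ l) == w ^+ 4)%:R
   = q4 ^+ (2 ^ l) * (l == 0)%:R + q2 ^+ (2 ^ l) * (l == 1)%:R + q1 ^+ (2 ^ l) * (l == 2)%:R :> F.
  move=> lh; rewrite /s !big_cons big_nil /= expr1n e1 // -!exprM.
  rewrite m4 -expnS.
  rewrite !(eq_prim_root_expr wn) !exp2_eq34_mod //; try lia.
  rewrite q3_0 !mulr0 !addr0 !addrA (expr0n _ (2 ^ l)) -leqn0 leqNgt expn_gt0 /=.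
  by rewrite mul0r addr0.
move: (key 4); rewrite (eq_bigr _ (fun l _ => t _ (ltn_ord l))) h_eq !big_ord_recl big1 /=.
  by rewrite expn0 expn1 !expr1 !mulr1 !mulr0 !addr0 !add0r addrA.
by move=> i _; rewrite !mulr0 !addr0.
Qed.

(** * Roots of unity and elements of norm 1 *)

Lemma primitive_root_exists n : (0 < n)%N -> (n %| #|F|.-1)%N -> exists w : F, n.-primitive_root w.
Proof.
move=> n0 nF; have F1 : (1 < #|F|)%N by rewrite finNzRing_gt1.
have F1' : (0 < #|F|.-1)%N by rewrite -subn1 subn_gt0.
have : has #|F|.-1.-primitive_root (enum [set~ (0 : F)]).
  apply: has_prim_root => //; first 1 last.
  - exact: enum_uniq.
  - by rewrite -cardE cardsC1.
  apply/allP => x; rewrite mem_enum !inE => x0; apply/unity_rootP.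
  by apply: (mulIf x0); rewrite mul1r -exprSr prednK ?expf_card // ltnW.
case/hasP => w _ wp; exists (w ^+ (#|F|.-1 %/ n)).
by apply: dvdn_prim_root.
Qed.

Lemma cardF_pred : (#|F|.-1 = (2 ^ h - 1) * (2 ^ h + 1))%N.
Proof. by rewrite cardF -subn1 -[1%N in LHS](exp1n 2) subn_sqr. Qed.

Lemma real_root : (3 <= h)%N ->
  exists w : F, [/\ (2 ^ h - 1)%N.-primitive_root w & forall i, c (w ^+ i) = w ^+ i].
Proof.
move=> h3; have [||w wp] := @primitive_root_exists (2 ^ h - 1).
- by have := exp2_ge8 h3; lia.
- by rewrite cardF_pred dvdn_mulr.
exists w; split=> // i; rewrite conjX; congr (_ ^+ _).
by rewrite /conjq -{1}(@subnK 1 (2 ^ h)) ?expn_gt0 // addn1 exprS (prim_expr_order wp) mulr1.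
Qed.

Lemma mu_root : exists w : F, [/\ (2 ^ h + 1)%N.-primitive_root w & forall i, w ^+ i * c (w ^+ i) = 1].
Proof.
have [||w wp] := @primitive_root_exists (2 ^ h + 1).
- by lia.
- by rewrite cardF_pred dvdn_mull.
exists w; split=> // i; rewrite conjX -exprMn /conjq -exprS -addn1 (prim_expr_order wp).
exact: expr1n.
Qed.

Lemma conj_half (x y : F) : c x = y * x -> x != 0 -> y * c y = 1.
Proof.
move=> xy x0; have e := conjK x; rewrite xy conjM xy in e.
by apply: (mulIf x0); rewrite mul1r [y * _]mulrC -mulrA.
Qed.

Lemma mu_neq0 (x : F) : x * c x = 1 -> x != 0.
Proof. by move=> x1; apply: contra_eqN x1 => /eqP->; rewrite mul0r eq_sym oner_neq0. Qed.

Lemma mu_conj (x : F) : x * c x = 1 -> c x = x^-1.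
Proof. by move=> x1; apply: (mulfI (mu_neq0 x1)); rewrite x1 mulfV ?mu_neq0. Qed.

(** Conjugation inverts [y], so it maps 1 + 1/y to 1 + y = y (1 + 1/y); this solution vanishes only
    for y = 1, where 1 serves instead. *)
Lemma hilbert90 (y : F) : y * c y = 1 -> exists2 x, x != 0 & c x = y * x.
Proof.
move=> y1; have y0 := mu_neq0 y1.
have [->|ny] := eqVneq y 1; first by exists 1; rewrite ?oner_neq0 // conj1 mulr1.
exists (1 + y^-1); last by rewrite conjD conj1 conjV (mu_conj y1) invrK mulrDr mulr1 mulfV // addrC.
by rewrite addr_eq0_2 eq_sym invr_eq1.
Qed.

(** * Roots of norm 1 of the self-reciprocal cubic *)

Section Cubic.
Variables (A t z : F).
Let n := A * c A.
Let B := A * z + 1.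
Hypotheses (z1 : z * c z = 1) (n1 : n + 1 != 0).
Hypothesis (root_z : A * z ^+ 3 + z ^+ 2 + t * z + t * c A = 0).

Let z0 := mu_neq0 z1.
Let cB_E : c B = c A / z + 1.
Proof. by rewrite conjD conjM conj1 (mu_conj z1). Qed.

(** [B] is the linear coefficient of the quotient of the cubic by y + z. If it vanished, [A] would
    be 1/z, of norm 1, against [n1]. *)
Lemma cubic_B_neq0 : B != 0.
Proof.
apply: contraNneq n1 => /eqP; rewrite addr_eq0_2 => /eqP Az.
rewrite /n; have -> : A = z^-1 by apply: (mulIf z0); rewrite Az mulVf.
by rewrite conjV -invfM z1 invr1 addxx2 eqxx.
Qed.

Let B0 := cubic_B_neq0.
Let cB0 : c B != 0. Proof. by rewrite conj_eq0. Qed.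

(** The cubic is linear in [t], with coefficient z + c A = z * c B. *)
Lemma cubic_t : t = z * B / c B.
Proof.
apply: (mulIf cB0); rewrite mulfVK // cB_E; apply: (mulIf z0).
apply/eqP; rewrite -addr_eq0_2 -[X in _ == X]root_z; apply/eqP.
by rewrite /B; field2 pchar2.
Qed.

Lemma cubic_const : A * z ^+ 2 + z + t = B * c A / c B.
Proof.
have -> : B * c A / c B = t * c A / z by rewrite [in RHS]cubic_t; field2 pchar2.
apply: (mulIf z0); rewrite mulfVK //.
apply/eqP; rewrite -addr_eq0_2 -[X in _ == X]root_z; apply/eqP.
by field2 pchar2.
Qed.

(** The right side is the Artin-Schreier invariant of the quadratic left after dividing by y + z. It
    differs by u^2 + u, with [u] in F_q, from an expression that no longer involves the root [z]. *)
Lemma cubic_trace : Tr ((t * A + c A / t + n ^+ 2) / (n + 1) ^+ 2) = Tr (n / (B * c B)).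
Proof.
pose u := (1 + A * z + c A / z) / (n + 1).
have ur : c u = u.
  rewrite /u /n !conjE (mu_conj z1) invrK [c A * A]mulrC -!addrA.
  by congr ((1 + _) / _); rewrite addrC.
rewrite -[RHS](Tr_AS_real _ ur); congr absTr.
have n1' : A * c A + 1 != 0 := n1.
have B0' : A * z + 1 != 0 := B0.
have cB0' : c A + z != 0.
  by have := cB0; rewrite cB_E -(mulfK z0 1) mul1r -mulrDl mulf_eq0 negb_or => /andP[].
rewrite cubic_t /u cB_E /B /n; field2 pchar2.
Qed.

(** Put u = A y / B. The quotient quadratic becomes u^2 + u = n / (B c B), and for [y] of norm 1 the
    same quadratic divided by B y reads c u + u = 1. *)
Lemma cubic_root_neq y : y * c y = 1 -> y != z ->
  A * y ^+ 3 + y ^+ 2 + t * y + t * c A = 0 -> Tr (n / (B * c B)) = 1.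
Proof.
move=> y1 yz root_y; have y0 := mu_neq0 y1.
have quad : A * y ^+ 2 + B * y + (A * z ^+ 2 + z + t) = 0.
  apply: (mulIf (_ : y + z != 0)); first by rewrite addr_eq0_2.
  by rewrite mul0r -[RHS](addxx2 0) -{1}root_y -root_z /B; field2 pchar2.
have quad' : A * y ^+ 2 + B * y + B * c A / c B = 0.
  by rewrite -cubic_const.
pose u := A * y / B.
have -> : n / (B * c B) = u ^+ 2 + u.
  apply/eqP; rewrite -addr_eq0_2; apply/eqP.
  rewrite -[RHS](mulr0 (A / B ^+ 2)) -quad' /u /n; field2 pchar2.
rewrite Tr_AS /u conjM conjV [c (A * y)]conjM (mu_conj y1).
apply/eqP; rewrite -addr_eq0_2; apply/eqP.
by rewrite -[RHS](mulr0 (B * y)^-1) -quad'; field2 pchar2.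
Qed.

(** Conversely, both solutions [u] and [u + 1] of the Artin-Schreier equation give roots B u / A of
    norm 1. They differ by B / A, so one of them is not [z]. *)
Lemma cubic_other_root : Tr (n / (B * c B)) = 1 ->
  exists2 y, y * c y = 1 /\ y != z & A * y ^+ 3 + y ^+ 2 + t * y + t * c A = 0.
Proof.
move=> Tr1; have xr : c (n / (B * c B)) = n / (B * c B).
  by rewrite /n !conjM conjV conjM !conjK; congr (_ / _); rewrite mulrC.
have [u ux] := AS_solve xr; rewrite -ux Tr_AS in Tr1.
(* For A = 0 the equation leaves only u = 0 or u = 1, where c u + u is 0 and not 1. *)
have A0 : A != 0.
  apply: contra_eqN Tr1 => /eqP A0; move: ux; rewrite /n A0 mul0r mul0r.
  have -> : u ^+ 2 + u = u * (u + 1) by field2 pchar2.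
  move/eqP; rewrite mulf_eq0 addr_eq0_2 => /orP[] /eqP->.
    by rewrite conj0 addr0 eq_sym oner_neq0.
  by rewrite conj1 addxx2 eq_sym oner_neq0.
have cA0 : c A != 0 by rewrite conj_eq0.
have root v : v ^+ 2 + v = n / (B * c B) -> c v + v = 1 -> let y := B * v / A in
    y * c y = 1 /\ A * y ^+ 3 + y ^+ 2 + t * y + t * c A = 0.
  move=> vx /eqP; rewrite -addr_eq0_2 => /eqP v1 /=; split.
    have cv : c v = v + 1.
      by apply/eqP; rewrite -addr_eq0_2 -[X in _ == X]v1; apply/eqP; field2 pchar2.
    rewrite !conjM conjV cv; apply/eqP; rewrite -addr_eq0_2; apply/eqP.
    have -> : B * v / A * (c B * (v + 1) / c A) + 1 =
       (v ^+ 2 + v + n / (B * c B)) * (B * c B) / n by rewrite /n; field2 pchar2.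
    by rewrite vx addxx2 !mul0r.
  have -> : A * (B * v / A) ^+ 3 + (B * v / A) ^+ 2 + t * (B * v / A) + t * c A =
     (B * v / A + z) * (B ^+ 2 / A * (v ^+ 2 + v + n / (B * c B)) + 
       (A * z ^+ 2 + z + t + B * c A / c B)) +
     (A * z ^+ 3 + z ^+ 2 + t * z + t * c A).
    by rewrite /B /n; field2 pchar2.
  by rewrite vx addxx2 root_z cubic_const addxx2 !(mulr0, addr0).
have [y1 yr] := root u ux Tr1.
have [e|] := eqVneq (B * u / A) z; last by exists (B * u / A).
have [||y1' yr'] := root (u + 1).
- by rewrite -ux; field2 pchar2.
- by rewrite conjD conj1 -Tr1; field2 pchar2.
exists (B * (u + 1) / A) => //; split=> //.
rewrite -e -addr_eq0_2.
have -> : B * (u + 1) / A + B * u / A = B / A by field2 pchar2.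
by rewrite mulf_neq0 ?invr_neq0.
Qed.

End Cubic.

Definition resolvent (a b t : F) : F :=
  let A := c a + t * b in (t * A + c A / t + (A * c A) ^+ 2) / (A * c A + 1) ^+ 2.

(** * From the trinomial to the cubic *)

Section Trinomial.
Variables (a b : F).
Local Notation f := (f_ab (2 ^ h) a b).
Local Notation A t := (c a + t * b).
Local Notation den y := (b * y ^+ 3 + y + a).
Local Notation num y := (c a * y ^+ 3 + y ^+ 2 + c b).

Lemma f_ab0 : f 0 = 0.
Proof. by rewrite /f_ab !addn1 !expr0n !mulr0 !addr0. Qed.

(** With y = x^(q-1) of norm 1, y^q = 1/y and hence f(x) = x (1 + a/y + b y^2). *)
Lemma f_abE (x y : F) : x != 0 -> c x = y * x -> f x = x * den y / y.
Proof.
move=> x0 xy; have y1 := conj_half xy x0; have y0 := mu_neq0 y1.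
have xq : x ^+ (2 ^ h - 1) = y.
  by apply: (mulIf x0); rewrite -exprSr -addn1 subnK ?expn_gt0 // -xy.
rewrite /f_ab !addn1 !exprSr [(2 ^ h * _)%N]mulnC [(2 * _)%N]mulnC !exprM xq.
by rewrite -/(conjq h y) (mu_conj y1); field2 pchar2.
Qed.

Lemma conj_den (y : F) : y * c y = 1 -> c (den y) = num y / y ^+ 3.
Proof.
move=> y1; have y0 := mu_neq0 y1.
by rewrite !conjE (mu_conj y1); field2 pchar2.
Qed.

Lemma conj_f_ab (x y : F) : x != 0 -> c x = y * x -> c (f x) = x * num y / y.
Proof.
move=> x0 xy; have y1 := conj_half xy x0; have y0 := mu_neq0 y1.
rewrite (f_abE x0 xy) !conjM conjV (mu_conj y1) xy conj_den //.
by field2 pchar2.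
Qed.

Lemma f_ab_homog (r x : F) : c r = r -> f (r * x) = r * f x.
Proof.
move=> rr; have [->|r0] := eqVneq r 0; first by rewrite !mul0r f_ab0.
have rq : r ^+ (2 ^ h - 1) = 1.
  by apply: (mulIf r0); rewrite -exprSr -addn1 subnK ?expn_gt0 // mul1r.
rewrite /f_ab !addn1 !exprSr !exprMn [(2 ^ h * _)%N]mulnC [(2 * _)%N]mulnC !(exprM r) rq.
rewrite !expr1n !mul1r; set X := x ^+ (_ * 2 ^ h); set Y := x ^+ (_ * 2).
by field2 pchar2.
Qed.

Lemma conj_A (t : F) : t * c t = 1 -> t * c (A t) = t * a + c b.
Proof. by move=> t1; rewrite !conjE mulrDr mulrA t1 mul1r. Qed.

Lemma cubic_eq (t z : F) : t * c t = 1 ->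
  A t * z ^+ 3 + z ^+ 2 + t * z + t * c (A t) = num z + t * den z.
Proof. by move=> t1; rewrite conj_A //; field2 pchar2. Qed.

Lemma cubic_of_value (t x z : F) : x != 0 -> c x = z * x -> t * c t = 1 ->
  c (f x) = t * f x -> A t * z ^+ 3 + z ^+ 2 + t * z + t * c (A t) = 0.
Proof.
move=> x0 cx t1; rewrite (conj_f_ab x0 cx) (f_abE x0 cx) cubic_eq // => e.
have z0 := mu_neq0 (conj_half cx x0).
apply: (mulfI (mulf_neq0 x0 (invr_neq0 z0))).
rewrite mulr0 -[RHS](addxx2 (x * num z / z)) {2}e.
by field2 pchar2.
Qed.

(** Surjectivity supplies one root of the cubic in mu; trace 1 would supply a second one, and this
    contradicts injectivity. *)
Lemma bij_resolvent (t : F) : bijective f -> t * c t = 1 -> A t * c (A t) + 1 != 0 ->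
  Tr (resolvent a b t) = 0.
Proof.
move=> fbij t1 n1; have finj := bij_inj fbij; case: fbij => f' _ f'K.
have [x' x'0 cx'] := hilbert90 t1.
have fx := f'K x'; set x := f' x' in fx.
have x0 : x != 0 by apply: contra_neq x'0 => x0; rewrite -fx x0 f_ab0.
pose z := c x / x; have cx : c x = z * x by rewrite mulfVK.
have z1 := conj_half cx x0; have z0 := mu_neq0 z1.
have root_z : A t * z ^+ 3 + z ^+ 2 + t * z + t * c (A t) = 0.
  by apply: cubic_of_value cx t1 _ => //; rewrite fx cx'.
rewrite /resolvent (cubic_trace z1 n1 root_z).
set X := _ / _; have Xr : c X = X.
  by rewrite /X conjM conjV !conjM !conjK [c (A t) * _]mulrC [c _ * (_ * z + 1)]mulrC.
have [//|Tr1] := Tr01 Xr.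
have [y [y1 yz] root_y] := cubic_other_root z1 n1 root_z Tr1.
have y0 := mu_neq0 y1; have [x2 x20 cx2] := hilbert90 y1.
have e : num y = t * den y.
  by apply/eqP; rewrite -addr_eq0_2 -cubic_eq // root_y.
have cf : c (f x2) = t * f x2.
  by rewrite (conj_f_ab x20 cx2) (f_abE x20 cx2) e; field2 pchar2.
have f20 : f x2 != 0 by rewrite -f_ab0 (inj_eq finj).
(* [f x2] and [x'] lie on one F_q-line, so scaling [x2] by [r] in F_q gives it the same image as
   [x], although the ratios [y] and [z] differ. *)
pose r := x' / f x2; have rr : c r = r.
  by rewrite /r conjM conjV cx' cf; have t0 := mu_neq0 t1; field2 pchar2.
have : f (r * x2) = f x by rewrite f_ab_homog // /r mulfVK.
move/finj => xE; have r0 : r != 0 by rewrite mulf_neq0 ?invr_neq0.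
case/eqP: yz; rewrite /z -xE conjM rr cx2; field2 pchar2.
Qed.

Lemma resolvent_inj :
  (forall t, t * c t = 1 -> A t * c (A t) + 1 != 0 -> Tr (resolvent a b t) = 0) ->
  (forall t, t * c t = 1 -> A t * c (A t) + 1 = 0 -> t * A t = 1) ->
  (forall y, y * c y = 1 -> den y != 0) ->
  injective f.
Proof.
move=> Hres Htriple Hden.
have f_eq0 x : f x = 0 -> x = 0.
  move=> fx; apply/eqP/negPn/negP => x0; have cx : c x = (c x / x) * x by rewrite mulfVK.
  have y1 := conj_half cx x0; move/eqP: fx; rewrite (f_abE x0 cx).
  by rewrite !mulf_eq0 invr_eq0 (negbTE x0) (negbTE (Hden _ y1)) (negbTE (mu_neq0 y1)).
move=> x1 x2 fe.
have [x10|x10] := eqVneq x1 0; first by rewrite x10; apply/esym/f_eq0; rewrite -fe x10 f_ab0.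
have [x20|x20] := eqVneq x2 0; first by rewrite x20; apply: f_eq0; rewrite fe x20 f_ab0.
pose z := c x1 / x1; have cx1 : c x1 = z * x1 by rewrite mulfVK.
pose y := c x2 / x2; have cx2 : c x2 = y * x2 by rewrite mulfVK.
have z1 := conj_half cx1 x10; have y1 := conj_half cx2 x20.
have dz0 := Hden _ z1; have dy0 := Hden _ y1.
have z0 := mu_neq0 z1; have y0 := mu_neq0 y1.
suff yz : y = z.
  move: fe; rewrite (f_abE x10 cx1) (f_abE x20 cx2) yz => /(mulIf (invr_neq0 z0)).
  exact: mulIf.
have fx0 : f x1 != 0 by apply: contra_neq x10; exact: f_eq0.
pose t := c (f x1) / f x1; have ct : c (f x1) = t * f x1 by rewrite mulfVK.
have t1 := conj_half ct fx0.
have root_z := cubic_of_value x10 cx1 t1 ct.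
have root_y : A t * y ^+ 3 + y ^+ 2 + t * y + t * c (A t) = 0.
  by apply: cubic_of_value cx2 t1 _ => //; rewrite -fe.
(* Where the denominator of the resolvent vanishes, [Htriple] turns the cubic into (v + t)^3 / t,
   whose only root is [t]. *)
have [n1|n1] := eqVneq (A t * c (A t) + 1) 0.
  have tA := Htriple t t1 n1; have t0 := mu_neq0 t1.
  have At : A t = t^-1 by apply: (mulfI t0); rewrite tA mulfV.
  suff root_t v : A t * v ^+ 3 + v ^+ 2 + t * v + t * c (A t) = 0 -> v = t.
    by rewrite (root_t z root_z); exact: root_t.
  rewrite At conjV (mu_conj t1) invrK => e.
  have : (v + t) ^+ 3 = 0 by rewrite -[RHS](mulr0 t) -e; field2 pchar2.
  by move/eqP; rewrite expf_eq0 addr_eq0_2 => /eqP.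
apply/eqP/negPn/negP => yz.
have := cubic_root_neq z1 n1 root_z y1 yz root_y.
rewrite -(cubic_trace z1 n1 root_z) -/(resolvent a b t) Hres // => /esym/eqP.
by rewrite oner_eq0.
Qed.

End Trinomial.

(** * The resolvent when a b lies in F_q *)

Section Normalized.
Variables (a b : F).
Hypotheses (a0 : a != 0) (b0 : b != 0) (h3 : (3 <= h)%N).
Hypothesis ab_real : c (a * b) = a * b.
Let g := a * b.
Let E := 1 + a * c a + b * c b.
Local Notation A t := (c a + t * b).

Let cb0 : c b != 0. Proof. by rewrite conj_eq0. Qed.
Let g0 : g != 0. Proof. by rewrite mulf_neq0. Qed.

Let caE : c a = a * b / c b.
Proof. by rewrite -ab_real conjM mulfK. Qed.

Let E_real : c E = E.
Proof. by rewrite /E !conjD !conjM !conjK conj1 [c a * a]mulrC [c b * b]mulrC. Qed.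

Lemma norm_AE (t : F) : t * c t = 1 -> A t * c (A t) + 1 = E + g * (t + t^-1).
Proof.
move=> t1; have t0 := mu_neq0 t1; rewrite /E /g !conjD !conjM !conjK (mu_conj t1) caE.
by field2 pchar2.
Qed.

(** With D = E + g (t + 1/t), the square of A c A = D + 1 contributes D^2 + 1 to the numerator; D^2
    yields the final summand 1. *)
Lemma resolventE (t : F) : t * c t = 1 -> E + g * (t + t^-1) != 0 ->
  resolvent a b t = (b * t ^+ 2 + c a * t + 1 + a / t + c b / t ^+ 2) / (E + g * (t + t^-1)) ^+ 2 + 1.
Proof.
move=> t1; have t0 := mu_neq0 t1; rewrite -norm_AE // /resolvent.
set n := A t * c (A t) + 1 => n0.
have -> : A t * c (A t) = n + 1 by rewrite /n; field2 pchar2.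
rewrite !conjD !conjM !conjK (mu_conj t1).
by field2 pchar2.
Qed.


(** The two alternatives of the theorem with q-th powers written as conjugates; [b * a = c a] stands
    for b = a^(q-1). *)
Definition trinomial_cond := 
  b * a = c a /\ Tr (1 + (a * c a)^-1) = 0 \/
  [/\ b * E + c a ^+ 2 = 0, b * c b != 1 & Tr (b * c b / (a * c a)) = 0].

(** * Coefficients in F_q and sufficiency of the conditions *)

Section RealCoefficients.
Hypotheses (a_real : c a = a) (b_real : c b = b).
Hypothesis (ab_curve : b = 1 \/ a ^+ 2 = b + b ^+ 2).

(** Up to v^2 + v with v = 1/(b D) in F_q, the resolvent is constant; the error is a multiple of (1
    + b)^3 (b + b^2 + a^2), which [ab_curve] kills. *)
Lemma real_resolvent (t : F) : t * c t = 1 -> A t * c (A t) + 1 != 0 ->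
  Tr (resolvent a b t) = Tr (1 + (a ^+ 2 * b)^-1).
Proof.
move=> t1 n0; have t0 := mu_neq0 t1; rewrite norm_AE // in n0.
pose w := t + t^-1; pose v := (b * (E + g * w))^-1.
have s0 : E + g * w != 0 by [].
have wr : c w = w by rewrite /w conjD conjV (mu_conj t1) invrK addrC.
have vr : c v = v by rewrite /v conjV conjM conjD conjM E_real ab_real wr b_real.
have c0 : (1 + b) ^+ 3 * (b + b ^+ 2 + a ^+ 2) = 0.
  by case: ab_curve => ->; rewrite addxx2 ?mulr0 // expr0n mul0r.
rewrite -[RHS](Tr_AS_real _ vr); congr absTr.
rewrite resolventE // -/w a_real b_real.
have -> : b * t ^+ 2 + a * t + 1 + a / t + b / t ^+ 2 = b * w ^+ 2 + a * w + 1.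
  by rewrite /w; field2 pchar2.
transitivity (1 + (a ^+ 2 * b)^-1 + (v ^+ 2 + v) +
   (1 + b) ^+ 3 * (b + b ^+ 2 + a ^+ 2) / (a ^+ 2 * b ^+ 2 * (E + g * w) ^+ 2)); last first.
  by rewrite c0 mul0r addr0.
have s0' : 1 + a * a + b * b + a * b * w != 0 by move: s0; rewrite /E /g a_real b_real.
by rewrite /v /E /g a_real b_real; field2 pchar2.
Qed.

End RealCoefficients.

(** In the first case [c a] equals a b, which is in F_q, so b = 1. In the second, multiplying by
    [c b ^+ 2] gives b (c b)^2 E = g^2, which makes [c b] a quotient of elements of F_q; the
    equation then factors as (1 + b)(b + b^2 + a^2) = 0. *)
Lemma cond_real : trinomial_cond ->
  [/\ c a = a, c b = b & b = 1 \/ a ^+ 2 = b + b ^+ 2].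
Proof.
suff : trinomial_cond -> c b = b /\ (c b = b -> c a = a -> b = 1 \/ a ^+ 2 = b + b ^+ 2).
  move=> H /H[br H']; have ar : c a = a by rewrite caE br mulfK.
  by split=> //; apply: H'.
case=> [[ba _]|[bE _ _]].
  have ar : c a = a by rewrite -[RHS]conjK -ba mulrC ab_real.
  have b1 : b = 1 by apply: (mulIf a0); rewrite ba ar mul1r.
  by rewrite b1 conj1; split=> //; left.
have bE' : b * c b ^+ 2 * E = g ^+ 2.
  apply/eqP; rewrite -addr_eq0_2; apply/eqP.
  transitivity (c b ^+ 2 * (b * E + c a ^+ 2)); last by rewrite bE mulr0.
  by rewrite caE /g; field2 pchar2.
have bE0 : b * c b * E != 0.
  apply: contra_neq g0 => z; apply/eqP; rewrite -sqrf_eq0 -bE'.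
  have -> : b * c b ^+ 2 * E = b * c b * E * c b by field2 pchar2.
  by rewrite z mul0r.
have br : c b = b.
  apply: (mulfI bE0); transitivity (g ^+ 2); first by rewrite -bE'; field2 pchar2.
  rewrite -[g ^+ 2](_ : c (g ^+ 2) = _); last by rewrite conjX ab_real.
  by rewrite -bE' conjM conjM [c (c b ^+ 2)]conjX conjK E_real; field2 pchar2.
split=> // _ ar; have : (1 + b) * (b + b ^+ 2 + a ^+ 2) = 0.
  by rewrite -bE /E br ar; field2 pchar2.
move/eqP; rewrite mulf_eq0 => /orP[]; rewrite addr_eq0_2 => /eqP; first by left.
by right.
Qed.

(** In the second case this constant differs from N(b)/N(a) by 1/b^2 + 1/b, of trace 0. *)
Lemma cond_Tr : trinomial_cond -> Tr (1 + (a ^+ 2 * b)^-1) = 0.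
Proof.
move=> C; have [ar br _] := cond_real C; case: C => [[ba Tr0]|[bE nb Tr0]].
  have b1 : b = 1 by apply: (mulIf a0); rewrite ba ar mul1r.
  by rewrite b1 mulr1 expr2 -{2}ar.
have b1 : 1 + b != 0 by rewrite addr_eq0_2; apply: contra_neq nb => <-; rewrite conj1 mulr1.
have a2 : a ^+ 2 = b + b ^+ 2.
  apply/eqP; rewrite -addr_eq0_2 -(mulrI_eq0 _ (mulfI b1)); apply/eqP.
  by rewrite -[RHS]bE /E br ar; field2 pchar2.
have bir : c b^-1 = b^-1 by rewrite conjV br.
rewrite -Tr0 -[RHS](Tr_AS_real _ bir) br ar -!expr2 a2; congr absTr.
have b2 : b + b ^+ 2 != 0 by rewrite -a2 expf_neq0.
by field2 pchar2.
Qed.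

(** The element is u^2 + u for u = y / (y + 1/y), and conjugation sends this [u] to u + 1. In
    [cond_inj] this excludes unwanted zeros on mu. *)
Lemma mu_Tr (y : F) : y * c y = 1 -> y + y^-1 != 0 -> Tr ((y + y^-1) ^+ 2)^-1 = 1.
Proof.
move=> y1 w0; have y0 := mu_neq0 y1.
have w0' : y ^+ 2 + 1 != 0.
  rewrite (_ : y ^+ 2 + 1 = y * (y + y^-1)) ?mulf_neq0 //; by field2 pchar2.
have -> : ((y + y^-1) ^+ 2)^-1 = (y / (y + y^-1)) ^+ 2 + y / (y + y^-1) by field2 pchar2.
rewrite Tr_AS conjM conjV conjD conjV (mu_conj y1) invrK.
have w0'' : 1 + y ^+ 2 != 0 by rewrite addrC.
by field2 pchar2.
Qed.

Lemma cond_inj : trinomial_cond -> injective (f_ab (2 ^ h) a b).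
Proof.
move=> C; have [ar br ab_curve] := cond_real C.
have Tr0 := cond_Tr C; have b1_or : b = 1 \/ a ^+ 2 = b + b ^+ 2 /\ 1 + b != 0.
  case: ab_curve => [|a2]; [by left|right; split=> //].
  apply: contra_neq a0 => b1; apply/eqP; rewrite -sqrf_eq0 a2.
  by rewrite -[b in b + _]mulr1 -mulrDr b1 mulr0.
have bir : c b^-1 = b^-1 by rewrite conjV br.
apply: resolvent_inj => [t t1 n0|t t1|y y1].
- by rewrite real_resolvent // cond_Tr.
(* At a zero of D, b = 1 forces a = t + 1/t and the triple root. Otherwise t + 1/t = (1 + b)/(a b),
   and [mu_Tr] contradicts [cond_Tr]. *)
- rewrite norm_AE // /E /g ar br; have t0 := mu_neq0 t1 => n0.
  case: b1_or => [b1|[a2 b1]].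
    have ta : a = t + t^-1.
      apply: (mulfI a0); apply/eqP; rewrite -addr_eq0_2 -[X in _ == X]n0 b1; apply/eqP.
      by field2 pchar2.
    by rewrite b1 ta; field2 pchar2.
  have wE : t + t^-1 = (1 + b) / (a * b).
    apply: (mulfI (mulf_neq0 a0 b0)); apply/eqP.
    rewrite -addr_eq0_2 -[X in _ == X]n0 -[a * a]/(a ^+ 2) a2; apply/eqP; field2 pchar2.
  have w0 : t + t^-1 != 0 by rewrite wE !mulf_neq0 ?invr_neq0 ?mulf_neq0.
  have := mu_Tr t1 w0; have ur : c (b + b^-1) = b + b^-1 by rewrite conjD br bir.
  rewrite -(Tr_AS_real _ ur) wE (_ : _ + _ = 1 + (a ^+ 2 * b)^-1).
    by rewrite Tr0 => /esym/eqP; rewrite oner_eq0.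
  transitivity (a ^+ 2 * b ^+ 2 / (1 + b) ^+ 2 + ((b + b^-1) ^+ 2 + (b + b^-1))).
    by field2 pchar2.
  by rewrite a2; have b2 : b + b ^+ 2 != 0 by [rewrite -a2 expf_neq0]; field2 pchar2.
(* By conjugation a zero of the denominator of g is a zero of its numerator. Eliminating y^3 leaves
   the quadratic [q0], which leads to a = 0 if b = 1, and otherwise to y + 1/y = a/b against
   [mu_Tr]. *)
have y0 := mu_neq0 y1; apply/eqP => d0.
have n0 : b + y ^+ 2 + a * y ^+ 3 = 0.
  have := conj_den a b y1; rewrite d0 conj0 ar br => /esym/eqP.
  by rewrite mulf_eq0 invr_eq0 (negbTE (expf_neq0 _ y0)) orbF => /eqP <-; field2 pchar2.
have q0 : b * y ^+ 2 + a * y + (a ^+ 2 + b ^+ 2) = 0.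
  transitivity (a * (b * y ^+ 3 + y + a) + b * (b + y ^+ 2 + a * y ^+ 3)); first by field2 pchar2.
  by rewrite d0 n0 !mulr0 addr0.
case: b1_or => [b1|[a2 b1]].
  have y2 : y ^+ 2 = 1.
    apply: (mulfI (mulf_neq0 (expf_neq0 2 a0) y0)); apply/eqP.
    rewrite -addr_eq0_2; apply/eqP.
    transitivity (y * (b * y ^+ 2 + a * y + (a ^+ 2 + b ^+ 2)) + (b * y ^+ 3 + y + a)
      + a * (b + y ^+ 2 + a * y ^+ 3)); first by rewrite b1; field2 pchar2.
    by rewrite q0 d0 n0 !mulr0 !addr0.
  case/eqP: a0; rewrite -[RHS]d0 b1 exprS y2; field2 pchar2.
have wE : y + y^-1 = a / b.
  apply: (mulfI (mulf_neq0 y0 b0)); apply/eqP.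
  rewrite -addr_eq0_2 -[X in _ == X]q0 a2; apply/eqP; field2 pchar2.
have w0 : y + y^-1 != 0 by rewrite wE mulf_neq0 ?invr_neq0.
have := mu_Tr y1 w0; rewrite -(Tr_AS_real _ bir) wE (_ : _ + _ = 1 + (a ^+ 2 * b)^-1).
  by rewrite Tr0 => /esym/eqP; rewrite oner_eq0.
transitivity (b ^+ 2 / a ^+ 2 + (b^-1 ^+ 2 + b^-1)); first by field2 pchar2.
by rewrite a2; have b2 : b + b ^+ 2 != 0 by [rewrite -a2 expf_neq0]; field2 pchar2.
Qed.

(** * Necessity: consequences of the vanishing traces *)

Hypothesis Tr_res :
  forall t, t * c t = 1 -> A t * c (A t) + 1 != 0 -> Tr (resolvent a b t) = 0.

Section BranchPoint.
Variable (z : F).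
Hypotheses (z0 : z != 0) (E0 : E != 0) (zE : E = g * (1 + z ^+ 2) / z).
Hypothesis (zz : c z = z \/ c z = z^-1).

Let z1 : 1 + z ^+ 2 != 0.
Proof. by apply: contra_neq E0 => z1; rewrite zE z1 mulr0 mul0r. Qed.

(** The zeros of D are [z] and 1/z. The substitution t = (s + z)/(z s + 1) puts them at s = 0 and s
    = oo, so D becomes a constant times s / ((s + z)(z s + 1)) and the denominators cancel up to
    s^2. *)
Lemma resolvent_laurent (s : F) : s != 0 -> s + z != 0 -> z * s + 1 != 0 ->
  (s + z) / (z * s + 1) * c ((s + z) / (z * s + 1)) = 1 ->
  let K := (g * (1 + z ^+ 2) ^+ 2 / z) ^+ 2 in
  Tr ((b + c a * z + z ^+ 2 + a * z ^+ 3 + c b * z ^+ 4) / K * s ^+ 2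
    + (1 + z ^+ 2) * (c a + a * z ^+ 2) / K * s
    + (((c a + a) * (z + z ^+ 3) + 1 + z ^+ 4) / K + 1)
    + (1 + z ^+ 2) * (c a * z ^+ 2 + a) / K * s^-1
    + (b * z ^+ 4 + c a * z ^+ 3 + z ^+ 2 + a * z + c b) / K * s^-1 ^+ 2) = 0.
Proof.
move=> s0 sz zs t1 K; set t := _ / _ in t1; have t0 := mu_neq0 t1.
have D : E + g * (t + t^-1) = g * (1 + z ^+ 2) ^+ 2 * s / (z * (s + z) * (z * s + 1)).
  by rewrite zE /t; field2 pchar2.
have D0 : E + g * (t + t^-1) != 0.
  by rewrite D !(mulf_neq0, invr_neq0, expf_neq0).
rewrite -[RHS](Tr_res t1) ?norm_AE // resolventE //.
congr absTr; rewrite D /t /K; field2 pchar2.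
Qed.

(** The Moebius map sends mu to mu if [z] is in F_q, and F_q to mu if [z] has norm 1; so [s] may run
    over the powers of a root of unity of order q + 1 or q - 1. The claim is then [Tr_laurent2]
    cleared of K = (E (1 + z^2))^2. *)
Lemma branch_point_condition :
  E ^+ 2 * (b + c a * z + z ^+ 2 + a * z ^+ 3 + c b * z ^+ 4) = (c a + a * z ^+ 2) ^+ 2.
Proof.
have [n [hn [w [wp H]]]] : exists n, [/\ n = 2 ^ h - 1 \/ n = 2 ^ h + 1 & exists w : F,
    [/\ n.-primitive_root w & forall i, (let s := w ^+ i in
    [/\ s != 0, s + z != 0, z * s + 1 != 0 &
     (s + z) / (z * s + 1) * c ((s + z) / (z * s + 1)) = 1])%R]]%N.
  case: zz => cz.
    exists (2 ^ h + 1)%N; split; first by right.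
    have [w [wp w1]] := mu_root; exists w; split=> // i s.
    have s1 : s * c s = 1 := w1 i; have s0 := mu_neq0 s1; have cs := mu_conj s1.
    (* Here [s] has norm 1 and [u] is in F_q, so equality would force u^2 = 1, which [z1]
       excludes. *)
    have ne u : (u = z \/ u = z^-1) -> s + u != 0.
      move=> hu; apply: contra_neq z1 => /eqP; rewrite addr_eq0_2 => /eqP su.
      have := s1; rewrite su; case: hu => ->; rewrite ?conjV cz -?invfM => e.
        by rewrite -expr2 in e; rewrite e addxx2.
      by move/(congr1 GRing.inv): e; rewrite invrK invr1 -expr2 => ->; rewrite addxx2.
    have sz : s + z != 0 by apply: ne; left.
    have zs : z * s + 1 != 0.
      have -> : z * s + 1 = z * (s + z^-1) by field2 pchar2.
      by rewrite mulf_neq0 // ne //; right.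
    split=> //; rewrite conjM conjV !conjD conjM conj1 cz cs.
    have sz' : 1 + z * s != 0 by rewrite addrC.
    have zs' : z + s != 0 by rewrite addrC.
    by field2 pchar2.
  exists (2 ^ h - 1)%N; split; first by left.
  have [w [wp w1]] := real_root h3; exists w; split=> // i s.
  have cs : c s = s := w1 i.
  have s0 : s != 0.
    apply/eqP => s0; have : w ^+ i ^+ (2 ^ h - 1) = 1 by rewrite exprAC (prim_expr_order wp) expr1n.
    rewrite -/s s0 expr0n (_ : (_ - 1 == 0)%N = false); last by have := exp2_ge8 h3; lia.
    by move/esym/eqP; rewrite oner_eq0.
  have ne u : (u = z \/ u = z^-1) -> s + u != 0.
    move=> hu; apply: contra_neq z1 => /eqP; rewrite addr_eq0_2 => /eqP su.
    have := cs; rewrite su; case: hu => ->; rewrite ?conjV cz ?invrK => e.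
      by rewrite expr2 -{1}e mulVf // addxx2.
    by rewrite expr2 {1}e mulVf // addxx2.
  have sz : s + z != 0 by apply: ne; left.
  have zs : z * s + 1 != 0.
    have -> : z * s + 1 = z * (s + z^-1) by field2 pchar2.
    by rewrite mulf_neq0 // ne //; right.
  split=> //; rewrite conjM conjV !conjD conjM conj1 cz cs.
  have sz' : s + z^-1 != 0 by apply: ne; right.
  have zs' : z^-1 * s + 1 != 0.
    have -> : z^-1 * s + 1 = z^-1 * (s + z) by field2 pchar2.
    by rewrite mulf_neq0 ?invr_neq0.
  by field2 pchar2.
set K := (g * (1 + z ^+ 2) ^+ 2 / z) ^+ 2.
have K0 : K != 0 by rewrite !(mulf_neq0, invr_neq0, expf_neq0).
have := @Tr_laurent2 n w _ _ _ _ _ h3 hn wp (fun i => let: And4 s0 sz zs t1 := H i in resolvent_laurent s0 sz zs t1).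
rewrite -/K => e.
have {}e : (b + c a * z + z ^+ 2 + a * z ^+ 3 + c b * z ^+ 4) * K = ((1 + z ^+ 2) * (c a + a * z ^+ 2)) ^+ 2.
  move: e; set P := b + _ + _ + _ + _; set Q := _ * (c a + _) => e.
  have -> : P * K = P / K * K ^+ 2 by field2 pchar2.
  by rewrite e; field2 pchar2.
apply: (mulIf (expf_neq0 2 z1)); rewrite -exprMn [_ * (1 + z ^+ 2)]mulrC -e /K zE.
by field2 pchar2.
Qed.

End BranchPoint.

(** With e = E/g, solve z^2 + e z + 1 = 0 by z = e u, where u^2 + u = 1/e^2. Since c u + u is 0 or
    1, [c z] is [z] or the other root z + e = 1/z. *)
Lemma branch_point_exists : E != 0 ->
  exists z, [/\ z != 0, E = g * (1 + z ^+ 2) / z & c z = z \/ c z = z^-1].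
Proof.
move=> E0; pose e := E / g; have e0 : e != 0 by rewrite mulf_neq0 ?invr_neq0.
have er : c e = e by rewrite /e conjM conjV E_real ab_real.
have vr : c (e ^+ 2)^-1 = (e ^+ 2)^-1 by rewrite conjV conjX er.
have [u ue] := AS_solve vr.
have u2 : u ^+ 2 = u + (e ^+ 2)^-1 by rewrite -ue; field2 pchar2.
have u0 : u != 0.
  apply: contra_eq_neq ue => ->; rewrite expr0n addr0 eq_sym.
  by rewrite invr_neq0 ?expf_neq0.
have z2 : (e * u) ^+ 2 = e * (e * u) + 1 by rewrite exprMn u2; field2 pchar2.
have z0 : e * u != 0 by rewrite mulf_neq0.
exists (e * u); split=> //.
  by rewrite z2 /e; field2 pchar2.
rewrite conjM er; have := Tr01 vr; rewrite -ue Tr_AS => -[] /eqP.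
  by rewrite addr_eq0_2 => /eqP->; left.
rewrite -addr_eq0_2 -addrA addr_eq0_2 => /eqP->; right.
apply: (mulIf z0); rewrite mulVf //.
transitivity ((e * u) ^+ 2 + e * (e * u)); first by field2 pchar2.
by rewrite z2; field2 pchar2.
Qed.

(** The conditions at [z] and 1/z say that [X'] and [X] satisfy one quadratic. Either X = X', which
    gives tau = 0, or Vieta's relations and elimination lead to tau (1 + N)^2 = 0. *)
Lemma nonzero_b_real : E != 0 -> c b = b.
Proof.
move=> E0; have [z [z0 zE zz]] := branch_point_exists E0.
have P1 := branch_point_condition z0 E0 zE zz.
have zi0 := invr_neq0 z0.
have zE' : E = g * (1 + z^-1 ^+ 2) / z^-1 by rewrite zE; field2 pchar2.
have zz' : c z^-1 = z^-1 \/ c z^-1 = z^-1^-1.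
  by rewrite conjV invrK; case: zz => ->; [left|right; rewrite invrK].
have P2 := branch_point_condition zi0 E0 zE' zz'.
pose N := b * c b; pose r := g / N; pose e := z + z^-1; pose tau := b + c b.
have N0 : N != 0 by rewrite mulf_neq0.
have r0 : r != 0 by rewrite mulf_neq0 ?invr_neq0.
have Ee : E = r * N * e by rewrite zE /r /e; field2 pchar2.
have EN : E = 1 + N + r ^+ 2 * N by rewrite /E caE /r /N /g; field2 pchar2.
have e0 : e != 0 by apply: contra_neq E0 => e0; rewrite Ee e0 mulr0.
pose X := b * z + c b / z; pose X' := b / z + c b * z.
(* As c a = r b and a = r c b, the condition at [z] divided by z^2 is the first hypothesis with x =
   [X']; the second one eliminates [y]. *)
have quad x y : E ^+ 2 * (y + r * x + 1) = r ^+ 2 * x ^+ 2 -> y = e * x + tau ->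
    r ^+ 2 * x ^+ 2 + E ^+ 2 * (e + r) * x + E ^+ 2 * (tau + 1) = 0.
  by move=> <- ->; field2 pchar2.
have q' : r ^+ 2 * X' ^+ 2 + E ^+ 2 * (e + r) * X' + E ^+ 2 * (tau + 1) = 0.
  apply: (quad _ (b / z ^+ 2 + c b * z ^+ 2)); last by rewrite /e /X' /tau; field2 pchar2.
  apply: (mulIf (expf_neq0 2 z0)); transitivity ((c a + a * z ^+ 2) ^+ 2).
    by rewrite -P1 caE /r /N /X' /g; field2 pchar2.
  by rewrite caE /r /X' /N /g; field2 pchar2.
have q : r ^+ 2 * X ^+ 2 + E ^+ 2 * (e + r) * X + E ^+ 2 * (tau + 1) = 0.
  apply: (quad _ (b * z ^+ 2 + c b / z ^+ 2)); last by rewrite /e /X /tau; field2 pchar2.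
  apply: (mulIf (expf_neq0 2 zi0)); transitivity ((c a + a * z^-1 ^+ 2) ^+ 2).
    by rewrite -P2 caE /r /N /X /g; field2 pchar2.
  by rewrite caE /r /X /N /g; field2 pchar2.
have S : X + X' = tau * e by rewrite /X /X' /tau /e; field2 pchar2.
have P : X * X' = tau ^+ 2 + N * e ^+ 2 by rewrite /X /X' /tau /e /N; field2 pchar2.
suff /eqP : tau = 0 by rewrite addr_eq0_2 => /eqP.
have sum0 : (X + X') * (r ^+ 2 * (X + X') + E ^+ 2 * (e + r)) = 0.
  by rewrite -[RHS](addxx2 0) -{1}q -q'; field2 pchar2.
have [XX|XX] := eqVneq (X + X') 0.
  by move: XX; rewrite S => /eqP; rewrite mulf_eq0 (negbTE e0) orbF => /eqP.
have {sum0} s1 : r ^+ 2 * (X + X') = E ^+ 2 * (e + r).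
  apply/eqP; rewrite -addr_eq0_2; move/eqP: sum0.
  by rewrite mulf_eq0 (negbTE XX).
have p1 : r ^+ 2 * (X * X') = E ^+ 2 * (tau + 1).
  apply/eqP; rewrite -addr_eq0_2; apply/eqP; rewrite -[RHS]q -s1; field2 pchar2.
rewrite S in s1; rewrite P in p1.
have t1 : r ^+ 2 * tau = E * (1 + N).
  apply: (mulIf e0); rewrite -mulrA s1.
  rewrite (_ : 1 + N = E + r ^+ 2 * N); last by rewrite EN; field2 pchar2.
  by rewrite Ee; field2 pchar2.
have t2 : N * (1 + N) * tau + E = N * E * (tau + 1).
  apply: (mulfI E0); transitivity (N * (r ^+ 2 * (tau ^+ 2 + N * e ^+ 2))); last first.
    by rewrite p1; field2 pchar2.
  transitivity (N * (r ^+ 2 * tau) * tau + (r * N * e) ^+ 2); last by field2 pchar2.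
  by rewrite t1 -Ee; field2 pchar2.
(* In this combination of [t1], [t2] and [EN] every term containing E cancels. *)
have t3 : tau * (1 + N) ^+ 2 = 0.
  apply: (mulfI (expf_neq0 2 r0)).
  transitivity ((r ^+ 2 * tau + E * (1 + N)) + (N * (1 + N) * tau + E + N * E * (tau + 1))
      + N * tau * (E + (1 + N + r ^+ 2 * N))); first by field2 pchar2.
  by rewrite t1 t2 -EN !addxx2 !mulr0 !addr0.
move/eqP: t3; rewrite mulf_eq0 expf_eq0 /= => /orP[/eqP //|/eqP N1].
move: t1; rewrite N1 mulr0 => /eqP.
by rewrite mulf_eq0 expf_eq0 (negbTE r0) => /eqP.
Qed.

(** For a, b in F_q the condition at [z] depends only on e = z + 1/z. Eliminating e by E = g e
    leaves exactly the error factor met in [real_resolvent]. *)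
Lemma nonzero_ab_curve : E != 0 -> b = 1 \/ a ^+ 2 = b + b ^+ 2.
Proof.
move=> E0; have br := nonzero_b_real E0; have ar : c a = a by rewrite caE br mulfK.
have [z [z0 zE zz]] := branch_point_exists E0.
have := branch_point_condition z0 E0 zE zz; rewrite ar br => P.
pose e := (1 + z ^+ 2) / z; have Ee : E = g * e by rewrite zE mulrA.
have e0 : e != 0 by apply: contra_neq E0 => e0; rewrite Ee e0 mulr0.
have {P} P : b ^+ 2 * (b * e ^+ 2 + a * e + 1) + 1 = 0.
  apply: (mulfI (mulf_neq0 (expf_neq0 2 (mulf_neq0 a0 e0)) (expf_neq0 2 z0))).
  rewrite mulr0 -[RHS](addxx2 (E ^+ 2 * (b + a * z + z ^+ 2 + a * z ^+ 3 + b * z ^+ 4))) {2}P.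
  by rewrite Ee /e /g; field2 pchar2.
have : (1 + b) ^+ 3 * (b + b ^+ 2 + a ^+ 2) = 0.
  transitivity (b * E ^+ 2 + a ^+ 2 * b * E + a ^+ 2 * b ^+ 2 + a ^+ 2).
    by rewrite /E ar br; field2 pchar2.
  transitivity (a ^+ 2 * (b ^+ 2 * (b * e ^+ 2 + a * e + 1) + 1)); last by rewrite P mulr0.
  by rewrite Ee /g; field2 pchar2.
move/eqP; rewrite mulf_eq0 expf_eq0 /= => /orP[]; rewrite addr_eq0_2 => /eqP; first by left.
by right.
Qed.

(** For E = 0, D has the double zero t = 1. The change t = 1 + 1/th moves it to oo, and th = s + o
    with [s] in F_q and c o = o + 1 keeps [t] on mu. The resolvent is then a quartic in [s];
    [Tr_quartic] puts a and b in F_q, E = 0 gives a = 1 + b, and a power of a must vanish. *)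
Lemma E_neq0 : E != 0.
Proof.
apply/negP => /eqP E0.
have [w [wp w1]] := mu_root; have {w1} w1 : w * c w = 1 by have := w1 1; rewrite expr1.
have w0 := mu_neq0 w1.
have ww : w + c w != 0.
  rewrite addr_eq0_2; apply/eqP => ww; have := w1; rewrite -ww -expr2 => /eqP.
  rewrite -(prim_order_dvd wp) => /dvdn_leq; have := exp2_ge8 h3; lia.
pose o := w / (w + c w); have co : c o = o + 1.
  by rewrite /o conjM conjV conjD conjK; have ww' : c w + w != 0 by [rewrite addrC]; field2 pchar2.
have [v [vp vr]] := real_root h3.
have H i : let s := v ^+ i in Tr
    ((b + c a + 1 + a + c b) / g ^+ 2 * s ^+ 4 + (c a + a) / g ^+ 2 * s ^+ 3 +
     (o * (c a + a) + c a + 1) / g ^+ 2 * s ^+ 2 + (o ^+ 2 * (c a + a) + c a) / g ^+ 2 * s +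
     (((b + c a + 1 + a + c b) * o ^+ 4 + (c a + a) * o ^+ 3 + (c a + 1) * o ^+ 2 + c a * o + b)
        / g ^+ 2 + 1)) = 0.
  move=> s; pose th := s + o; have cth : c th = th + 1 by rewrite /th conjD vr co addrA.
  have th0 : th != 0.
    by apply/eqP => th0; move/eqP: cth; rewrite th0 conj0 add0r eq_sym oner_eq0.
  have th1 : th + 1 != 0 by rewrite -cth conj_eq0.
  pose t := (th + 1) / th.
  have t1 : t * c t = 1 by rewrite /t conjM conjV conjD conj1 cth; field2 pchar2.
  have t0 := mu_neq0 t1.
  have D : E + g * (t + t^-1) = g / (th * (th + 1)) by rewrite E0 /t; field2 pchar2.
  have D0 : E + g * (t + t^-1) != 0 by rewrite D !(mulf_neq0, invr_neq0).
  rewrite -[RHS](Tr_res t1) ?norm_AE // resolventE //.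
  rewrite D /t; congr absTr; transitivity
   ((b * (th + 1) ^+ 4 + c a * (th + 1) ^+ 3 * th + (th + 1) ^+ 2 * th ^+ 2 +
     a * (th + 1) * th ^+ 3 + c b * th ^+ 4) / g ^+ 2 + 1); last by field2 pchar2.
  by rewrite /th; field2 pchar2.
have [q3 q] := Tr_quartic h3 vp H.
have ar : c a = a.
  by move/eqP: q3; rewrite mulf_eq0 invr_eq0 (negbTE (expf_neq0 _ g0)) orbF addr_eq0_2 => /eqP.
have br : c b = b by apply: (mulfI a0); rewrite -{1}ar -conjM ab_real.
have a1 : a = 1 + b.
  apply/eqP; rewrite -addr_eq0_2 -sqrf_eq0 -E0 /E ar br; apply/eqP; field2 pchar2.
have : (1 + b) ^+ 8 * (a ^+ 2) ^+ 2 = 0.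
  transitivity (0 * (g ^+ 2) ^+ 4); last by rewrite mul0r.
  have a1' : 1 + b != 0 by rewrite -a1.
  by rewrite -q ar br /g a1; field2 pchar2.
by rewrite -a1 => /eqP; rewrite mulf_eq0 !expf_eq0 (negbTE a0).
Qed.

Lemma res_cond : trinomial_cond.
Proof.
have E0 := E_neq0; have br := nonzero_b_real E0.
have ar : c a = a by rewrite caE br mulfK.
have curve := nonzero_ab_curve E0.
(* The constant trace is read off at t = 1, where D equals E and is nonzero. *)
have Tr1 : Tr (1 + (a ^+ 2 * b)^-1) = 0.
  have t1 : 1 * c 1 = 1 :> F by rewrite conj1 mulr1.
  have n0 : A 1 * c (A 1) + 1 != 0 by rewrite norm_AE // invr1 addxx2 mulr0 addr0.
  by rewrite -(real_resolvent ar br curve t1 n0) Tr_res.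
have [b1|b1] := eqVneq b 1.
  by left; rewrite b1 mul1r ar; split=> //; rewrite -Tr1 b1 mulr1.
right; case: curve => [b1'|a2]; first by rewrite b1' eqxx in b1.
have b1' : 1 + b != 0 by rewrite addr_eq0_2 eq_sym.
have bir : c b^-1 = b^-1 by rewrite conjV br.
have b2 : b + b ^+ 2 != 0 by rewrite -a2 expf_neq0.
rewrite ar br; split.
- by rewrite /E ar br -expr2 a2; field2 pchar2.
- by rewrite -expr2 -[X in _ != X](expr1n _ 2) sqr_eq_2.
- rewrite -Tr1 -[RHS](Tr_AS_real _ bir) -!expr2 a2; congr absTr.
  by field2 pchar2.
Qed.

End Normalized.

(** * Scaling to the case where a b lies in F_q *)

Lemma trinomial_cond_scale (a b e : F) : e * c e = 1 ->
  trinomial_cond a b -> trinomial_cond (a / e) (b * e ^+ 2).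
Proof.
move=> e1; have e0 := mu_neq0 e1.
have ca : c (a / e) = c a * e by rewrite conjM conjV (mu_conj e1) invrK.
have cb : c (b * e ^+ 2) = c b / e ^+ 2 by rewrite conjM conjX (mu_conj e1) exprVn.
have aa : a / e * (c a * e) = a * c a by field2 pchar2.
have bb : b * e ^+ 2 * (c b / e ^+ 2) = b * c b by field2 pchar2.
rewrite /trinomial_cond ca cb aa bb => -[[ba Tr0]|[bE nb Tr0]]; [left|right].
  by split=> //; rewrite -ba; field2 pchar2.
split=> //; rewrite -[RHS](mulr0 (e ^+ 2)) -bE; field2 pchar2.
Qed.

(** Since k^(q-1) = e and e^q = 1/e, the two higher monomials scale by k/e and k e^2. *)
Lemma f_ab_scale (a b e k x : F) : k != 0 -> c k = e * k ->
  f_ab (2 ^ h) a b (k * x) = k * f_ab (2 ^ h) (a / e) (b * e ^+ 2) x.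
Proof.
move=> k0 ke; have e1 := conj_half ke k0.
have kq : k ^+ (2 ^ h - 1) = e.
  by apply: (mulIf k0); rewrite -exprSr -addn1 subnK ?expn_gt0.
rewrite /f_ab !addn1 !exprSr !exprMn [(2 ^ h * _)%N]mulnC [(2 * _)%N]mulnC !(exprM k) kq.
rewrite -/(conjq h e) (mu_conj e1); set X := x ^+ (_ * 2 ^ h); set Y := x ^+ (_ * 2).
by have e0 := mu_neq0 e1; field2 pchar2.
Qed.

Lemma bij_scale (a b e k : F) : k != 0 -> c k = e * k ->
  bijective (f_ab (2 ^ h) a b) -> bijective (f_ab (2 ^ h) (a / e) (b * e ^+ 2)).
Proof.
move=> k0 ke /bij_inj finj; apply: injF_bij => x y xy; apply: (mulfI k0).
by apply: finj; rewrite !(f_ab_scale _ _ _ k0 ke) xy.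
Qed.

(** For [e] of norm 1 the requirement reads e^2 = c g / g; raising to the power 2^(2h-1) extracts
    the square root. *)
Lemma rotation_exists (g : F) : g != 0 ->
  exists2 e, e * c e = 1 & c (g * e) = g * e.
Proof.
move=> g0; have cg0 : c g != 0 by rewrite conj_eq0.
pose e := (c g / g) ^+ (2 ^ (h * 2).-1).
have e2 : e ^+ 2 = c g / g.
  rewrite /e -exprM -expnSr prednK ?muln_gt0 ?h_gt0 // expnM -cardF.
  exact: expf_card.
have e1 : e * c e = 1.
  apply/eqP; rewrite -sqr_eq_2 expr1n exprMn -conjX e2 conjM conjV conjK.
  by apply/eqP; field2 pchar2.
exists e => //; have e0 := mu_neq0 e1.
rewrite conjM (mu_conj e1); apply: (mulIf e0); rewrite mulfVK //.
by rewrite -mulrA -expr2 e2 mulrC mulfVK.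
Qed.

Lemma bij_trinomial_cond (a b : F) : (3 <= h)%N -> a != 0 -> b != 0 ->
  bijective (f_ab (2 ^ h) a b) <-> trinomial_cond a b.
Proof.
move=> h3 a0 b0; have [e e1 abe] := rotation_exists (mulf_neq0 a0 b0).
have e0 := mu_neq0 e1; have [k k0 ke] := hilbert90 e1.
have a10 : a / e != 0 by rewrite mulf_neq0 ?invr_neq0.
have b10 : b * e ^+ 2 != 0 by rewrite mulf_neq0 ?expf_neq0.
have abr : c (a / e * (b * e ^+ 2)) = a / e * (b * e ^+ 2).
  by rewrite (_ : a / e * (b * e ^+ 2) = a * b * e) //; field2 pchar2.
(* Scaling by 1/e undoes scaling by [e], which brings the condition and bijectivity back to the
   original coefficients. *)
have ei1 : e^-1 * c e^-1 = 1 by rewrite conjV -invfM e1 invr1.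
have aK : a / e / e^-1 = a by rewrite invrK mulfVK.
have bK : b * e ^+ 2 * e^-1 ^+ 2 = b by field2 pchar2.
split=> [fb|C].
  rewrite -aK -bK; apply: trinomial_cond_scale => //.
  have fb1 := bij_scale k0 ke fb.
  apply: res_cond => // t t1 n1; exact: bij_resolvent.
have ki0 := invr_neq0 k0; have kie : c k^-1 = e^-1 * k^-1 by rewrite conjV ke invfM.
rewrite -aK -bK; apply: (bij_scale ki0 kie); apply: injF_bij.
by apply: cond_inj => //; apply: trinomial_cond_scale.
Qed.

End ArtinSchreier.

Theorem theorem2 (F : finFieldType) (h : nat) (hh : (3 <= h)%N)
  (hcard : (#|F| = (2 ^ h) ^ 2)%N) (a b : F) (ha : a != 0) (hb : b != 0) :
  bijective (f_ab (2 ^ h) a b) <->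
  ((b = a ^+ (2 ^ h - 1) /\ absTr h (1 + (a ^+ (2 ^ h + 1))^-1) = 0) \/
   (b * (1 + a ^+ (2 ^ h + 1) + b ^+ (2 ^ h + 1)) + a ^+ (2 * 2 ^ h) = 0 /\
    b ^+ (2 ^ h + 1) != 1 /\
    absTr h (b ^+ (2 ^ h + 1) / a ^+ (2 ^ h + 1)) = 0)).
Proof.
have h_gt0 : (0 < h)%N by case: h hh {hcard}.
have normE (x : F) : x ^+ (2 ^ h + 1) = x * conjq h x by rewrite addn1 exprS.
have ba : b = a ^+ (2 ^ h - 1) <-> b * a = conjq h a.
  have ca : conjq h a = a ^+ (2 ^ h - 1) * a by rewrite -exprSr -addn1 subnK ?expn_gt0.
  by rewrite ca; split=> [->|/(mulIf ha)].
rewrite (bij_trinomial_cond h_gt0 hcard hh ha hb) /trinomial_cond !normE ba.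
rewrite mulnC exprM -/(conjq h a).
by split=> [[|[]]|[|[? []]]]; [left|right|left|right].
Qed.
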